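(* Let $X$ and $Y$ be compact metric spaces, each homeomorphic to the Cantor set. Let $f : X \to X$ be a continuous surjective mapping that is chain mixing, and let $g : Y \to Y$ be an aperiodic homeomorphism. Then the following conditions are equivalent: (1) $\mathrm{Per}(Y,g) \subseteq \mathrm{Per}(X,f)$; (2) $(Y,g) \vartriangleright (X,f)$.
   Context: A topological dynamical system is a pair $(X,f)$ where $(X,d)$ is a compact metric space and $f$ is a continuous mapping from $X$ onto itself. $\mathbf{Z}_+$ denotes the set of positive integers. Periodic points: $\mathrm{Per}(X,f) := \{ n \in \mathbf{Z}_+ \mid f^n(x) = x \text{ for some } x \in X\}$ (here $n$ need not be the least period of $x$). Chain mixing: for $\delta>0$, a sequence $x_0,x_1,\dots,x_l$ of elements of $X$ is a $\delta$ chain from $x_0$ to $x_l$ of length $l$ if $d(f(x_i),x_{i+1})<\delta$ for all $i=0,1,\dots,l-1$. $(X,f)$ (or $f$) is chain mixing if for every $\delta>0$ and every pair $x,y\in X$ there exists a positive integer $N$ such that for all $n\ge N$ there exists a $\delta$ chain from $x$ to $y$ of length $n$. Aperiodic: $g$ is periodic of period $n$ ($n \in \mathbf{Z}_+$) if $g^n = \mathrm{id}_Y$; $g$ is aperiodic if it is not periodic of period $n$ for any $n\in\mathbf{Z}_+$. The relation $\vartriangleright$: for topological dynamical systems $(Y,g)$ and $(X,f)$, $(Y,g)\vartriangleright(X,f)$ means that there exists a sequence of homeomorphisms $\psi_k : Y\to X$ ($k=1,2,\dots$) such that $\psi_k\circ g\circ\psi_k^{-1}\to f$ as $k\to\infty$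 uniformly, i.e. in the metric $d(f,f') := \sup_{x\in X} d(f(x),f'(x))$. *)

(* Defs.v *)
From mathcomp Require Export all_boot all_order all_algebra.
From mathcomp Require Export boolp classical_sets functions reals topology.
From mathcomp Require Export cantor.
Export numFieldTopology.Exports.

Set Implicit Arguments.
Unset Strict Implicit.
Unset Printing Implicit Defensive.

Import Order.TTheory GRing.Theory Num.Theory.
Local Open Scope classical_set_scope.
Local Open Scope ring_scope.

Definition inverse_homeomorphisms (X Y : topologicalType)
    (phi : X -> Y) (psi : Y -> X) : Prop :=
  [/\ continuous phi, continuous psi, cancel phi psi & cancel psi phi].

Definition homeomorphism (X Y : topologicalType) (phi : X -> Y) : Prop :=
  exists psi : Y -> X, inverse_homeomorphisms phi psi.

Definition homeomorphic (X Y : topologicalType) : Prop :=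
  exists phi : X -> Y, homeomorphism phi.

Definition Per (X : Type) (f : X -> X) : set nat :=
  [set n | (0 < n)%N /\ exists x : X, iter n f x = x].

Definition aperiodic (Y : Type) (g : Y -> Y) : Prop :=
  forall n : nat, (0 < n)%N -> ~ (forall y : Y, iter n g y = y).

(* The chain is x :: p, so its length (number of steps) is size p. *)
Definition delta_chain (R : realType) (X : metricType R) (f : X -> X)
    (delta : R) (x y : X) (l : nat) : Prop :=
  exists p : seq X,
    [/\ size p = l, path (fun a b => mdist (f a) b < delta) x p & last x p = y].

Definition chain_mixing (R : realType) (X : metricType R) (f : X -> X) : Prop :=
  forall delta : R, 0 < delta -> forall x y : X,
    exists N : nat, (0 < N)%N /\
      forall n : nat, (N <= n)%N -> delta_chain f delta x y n.

(* This is the uniform metric only when the distances are bounded (mathcomp's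
   sup is 0 on unbounded sets), as is the case when X is compact. *)
Definition sup_dist (R : realType) (X : metricType R) (f f' : X -> X) : R :=
  sup [set mdist (f x) (f' x) | x in [set: X]].

(* (Y, g) |> (X, f); the map phi k is the inverse of psi k. *)
Definition approximates (R : realType) (Y X : metricType R)
    (g : Y -> Y) (f : X -> X) : Prop :=
  exists (psi : nat -> Y -> X) (phi : nat -> X -> Y),
    (forall k : nat, inverse_homeomorphisms (psi k) (phi k)) /\
    sup_dist (psi k \o g \o phi k) f @[k --> \oo] --> (0 : R).

(* Main.v *)
Require Import Defs.
Local Open Scope classical_set_scope.

(** Why the theorem is true.

    If psi_k g psi_k^-1 converges uniformly to f and g has a point y with
    g^n y = y, then psi_k y is a point of period n of the k-th conjugate, and
    every cluster point of these points has period n under f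
    ([approximates_Per]).

    Conversely, fix a precision, and cut X into finitely many small clopen
    cylinders, labelled by a map U : X -> T ([fine_cantor_partition]).  Draw an
    edge from u to v when f maps some point of label u to a point of label v.
    Suppose that Y has a locally constant labelling V : Y -> T that takes all
    values and along which g follows the edges.  All the clopen sets V = t and
    U = t are Cantor sets, so there is a homeomorphism psi from Y to X with
    U o psi = V ([homeomorphisms_matching_partitions]), and psi g psi^-1 moves
    every point across an edge, as f does: the two maps are close.  Topology is
    thus reduced to finding V ([edge_labelling]), for a graph about which two
    facts are known.  Chain mixing gives walks of every large length between
    any two vertices, and even walks that visit all vertices
    ([chain_mixing_walks], [exists_covering_walk]).  Per(g) being part of
    Per(f), there is a closed walk of length n for each period n of g
    ([Per_closed_walk]).

    Let L be a length from which covering walks exist.  The points fixed by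
    g^(L!) include all points of period at most L; closed walks label them
    along edges, and the labelling, extended to Y, still follows edges on a
    neighbourhood of them ([periodic_labelling]).  Outside this neighbourhood
    the orbits do not come back to themselves before time L, so that there is a
    clopen set of markers which each orbit visits at times at least L apart,
    and often enough that all points far (in time) from the markers lie in the
    neighbourhood ([exists_markers]).  The labels of the markers and of these
    far points are kept, and in between the orbits are relabelled by covering
    walks ([labelling_from_markers]).  Aperiodicity provides one orbit with a
    marker, and the walk that follows this marker shows that all labels are
    taken. *)

Set Implicit Arguments.
Unset Strict Implicit.
Unset Printing Implicit Defensive.
Import Order.TTheory GRing.Theory Num.Theory.
Import metricType_numDomainType.

(** * Locally constant functions *)
Definition locally_constant (S : topologicalType) (T : Type) (V : S -> T) :=
  forall x, \forall z \near x, V z = V x.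

Section LocallyConstant.
Context {S : topologicalType}.

Lemma locally_constant_cst (T : Type) (t : T) :
  locally_constant (fun _ : S => t).
Proof. by move=> x; near=> z. Unshelve. all: by end_near. Qed.

(** The index V x may be frozen near each point, so that only the
    functions [W i] with constant index have to be inspected. *)
Lemma locally_constant_bind (I T : Type) (V : S -> I) (W : I -> S -> T) :
  locally_constant V -> (forall i, locally_constant (W i)) ->
  locally_constant (fun x => W (V x) x).
Proof.
move=> Vlc Wlc x; near=> z; have -> : V z = V x by near: z; exact: Vlc.
by near: z; exact: Wlc.
Unshelve. all: by end_near. Qed.

Lemma locally_constant_comp (I T : Type) (V : S -> I) (F : I -> T) :
  locally_constant V -> locally_constant (fun x => F (V x)).
Proof. by move=> Vlc x; near=> z; congr F; near: z; exact: Vlc.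
Unshelve. all: by end_near. Qed.

Lemma locally_constant_comp2 (I J T : Type) (V : S -> I) (W : S -> J)
    (F : I -> J -> T) :
  locally_constant V -> locally_constant W ->
  locally_constant (fun x => F (V x) (W x)).
Proof.
move=> Vlc Wlc; apply: (locally_constant_bind (W := fun i x => F i (W x))) => //.
by move=> i; exact: locally_constant_comp.
Qed.

Lemma locally_constant_map (I : Type) (T : Type) (V : I -> S -> T) (s : seq I) :
  (forall i, locally_constant (V i)) ->
  locally_constant (fun x => [seq V i x | i <- s]).
Proof.
move=> Vlc; elim: s => [|i s IHs]; first exact: locally_constant_cst.
exact: (locally_constant_comp2 cons).
Qed.

Lemma locally_constant_has (I : Type) (P : I -> S -> bool) (s : seq I) :
  (forall i, locally_constant (P i)) ->
  locally_constant (fun x => has (P^~ x) s).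
Proof.
move=> Plc; have /(locally_constant_comp (has id)) := locally_constant_map s Plc.
by congr locally_constant; apply/funext => x; rewrite has_map.
Qed.

Lemma locally_constant_all (I : Type) (P : I -> S -> bool) (s : seq I) :
  (forall i, locally_constant (P i)) ->
  locally_constant (fun x => all (P^~ x) s).
Proof.
move=> Plc; have /(locally_constant_comp (all id)) := locally_constant_map s Plc.
by congr locally_constant; apply/funext => x; rewrite all_map.
Qed.

Lemma locally_constant_find (I : Type) (P : I -> S -> bool) (s : seq I) :
  (forall i, locally_constant (P i)) ->
  locally_constant (fun x => find (P^~ x) s).
Proof.
move=> Plc; have /(locally_constant_comp (find id)) := locally_constant_map s Plc.
by congr locally_constant; apply/funext => x; rewrite find_map.
Qed.

Lemma locally_constant_preimage (S' : topologicalType) (T : Type)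
    (g : S' -> S) (V : S -> T) :
  continuous g -> locally_constant V -> locally_constant (fun x => V (g x)).
Proof. by move=> gcont Vlc x; exact: (gcont x _ (Vlc (g x))). Qed.

Lemma locally_constant_open (D : S -> bool) :
  locally_constant D -> open [set x | D x].
Proof.
move=> Dlc; rewrite openE => x Dx; rewrite /interior /=.
by apply: filterS (Dlc x) => z /= ->.
Qed.

End LocallyConstant.

Lemma continuous_iter (S : topologicalType) (g : S -> S) (n : nat) :
  continuous g -> continuous (iter n g).
Proof.
move=> gcont; elim: n => [|n IHn] x; first exact: cvg_id.
exact: (continuous_comp (IHn x) (gcont _)).
Qed.

Lemma finite_locally_constant_cover (S : topologicalType) (K : set S)
    (D : S -> S -> bool) : compact [set: S] -> closed K ->
  (forall y, K y -> locally_constant (D y) /\ D y y) ->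
  exists2 s : seq S, (forall y, y \in s -> K y) &
    forall z, K z -> exists2 y, y \in s & D y z.
Proof.
move=> Scompact Kclosed KD.
have Kcompact : compact K by apply: subclosed_compact Kclosed Scompact _.
(* A set of finite lists is large when it contains all the lists of indices
   that extend a given one; the covering form of compactness is applied to this
   filter. *)
pose valid (s : seq S) := forall y, y \in s -> K y.
pose F := filter_from valid
  (fun s => [set s' | valid s' /\ {subset s <= s'}]).
have FF : Filter F.
  apply: filter_from_filter; first by exists [::].
  move=> s1 s2 v1 v2; exists (s1 ++ s2).
    by move=> y; rewrite mem_cat => /orP[/v1|/v2].
  by move=> s [vs sub]; split; split=> // y ys; apply: sub;
    rewrite mem_cat ys ?orbT.
have /compact_near_coveringP/(_ _ F
  (fun s z => exists2 y, y \in s & D y z) FF) : compact K by [].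
case=> [x Kx|s0 vs0 cover].
  have [Dlc Dxx] := KD _ Kx.
  exists ([set z | D x z], [set s | valid s /\ {subset [:: x] <= s}]).
    split=> /=; first by apply: filterS (Dlc x) => z /= ->.
    by exists [:: x] => // y; rewrite inE => /eqP ->.
  move=> [z s] /= [Dxz [_ sub]]; exists x => //.
  by apply: sub; rewrite mem_head.
by exists s0 => [|z Kz] //; apply: (cover s0 (conj vs0 _) z Kz).
Qed.

(** * Clopen pieces of the Cantor space *)

Lemma locally_constant_bit (i : nat) :
  locally_constant (fun x : cantor_space => x i).
Proof.
move=> x; have := @proj_continuous nat (fun _ => bool) i x [set x i].
by apply; exact: discrete_set1.
Qed.

Definition agree (n : nat) (x z : nat -> bool) :=
  forall i, i < n -> z i = x i.

Lemma near_agree (n : nat) (x : cantor_space) :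
  \forall z \near x, agree n x z.
Proof.
elim: n => [|n IHn]; first by near=> z.
near=> z; move=> i; rewrite ltnS leq_eqVlt => /predU1P[->|].
  by near: z; exact: locally_constant_bit.
by move: i; near: z.
Unshelve. all: by end_near. Qed.

(** The filter generated by the cylinders around [x] converges to [x] coordinate
    by coordinate, hence in the product topology. *)
Lemma cylinder_basis (x : cantor_space) (O : set cantor_space) :
  nbhs x O -> exists n, forall z, agree n x z -> O z.
Proof.
pose F := filter_from [set: nat] (fun n => [set z : cantor_space | agree n x z]).
have FF : Filter F.
  apply: filter_from_filter; first by exists 0.
  move=> i j _ _; exists (maxn i j) => // z xz.
  by split=> k kn; apply: xz; rewrite leq_max kn ?orbT.
have Fx : F --> x.
  apply/cvg_sup => i U [V] [[W] oW <-] Wx WU.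
  apply: (filterS WU); exists i.+1 => // z xz.
  by rewrite /= xz.
by move=> /Fx[n _ nO]; exists n.
Qed.

Lemma continuous_bits (S : topologicalType) (h : S -> cantor_space) :
  (forall i, locally_constant (fun x => h x i)) -> continuous h.
Proof.
move=> hbit x O /cylinder_basis[n nO].
suff : \forall z \near x, agree n (h x) (h z).
  by apply: filterS => z xz; exact: nO.
elim: n {nO} => [|n IHn]; first by near=> z.
near=> z; move=> i; rewrite ltnS leq_eqVlt => /predU1P[->|].
  by near: z; exact: hbit.
by move: i; near: z.
Unshelve. all: by end_near. Qed.

Definition bit_cons (b : bool) (x : cantor_space) : cantor_space :=
  fun i => if i is i'.+1 then x i' else b.

Definition bit_tail (x : cantor_space) : cantor_space := fun i => x i.+1.

Lemma bit_consK (x : cantor_space) : bit_cons (x 0) (bit_tail x) = x.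
Proof. by apply/funext => -[]. Qed.

Lemma bit_cons_continuous (b : bool) : continuous (bit_cons b).
Proof.
apply: continuous_bits => -[|i]; first exact: locally_constant_cst.
exact: locally_constant_bit.
Qed.

Lemma bit_tail_continuous : continuous bit_tail.
Proof. by apply: continuous_bits => i; exact: locally_constant_bit. Qed.

Lemma continuous_bind (S S' : topologicalType) (I : Type) (V : S -> I)
    (W : I -> S -> S') :
  locally_constant V -> (forall i, continuous (W i)) ->
  continuous (fun x => W (V x) x).
Proof.
move=> Vlc Wcont x O /Wcont WO.
suff : \forall z \near x, O (W (V z) z) by [].
near=> z; have -> : V z = V x by near: z; exact: Vlc.
by near: z; exact: WO.
Unshelve. all: by end_near. Qed.

(** The clopen set [D] is homeomorphic to the Cantor space.  The map [h] is
    total, with unspecified values outside [D]: this avoids a topology on the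
    subtype, and such maps are glued by cases on a locally constant function. *)
Definition cantor_piece (S : topologicalType) (D : S -> bool) :=
  exists (h : S -> cantor_space) (k : cantor_space -> S),
  [/\ continuous h, continuous k, forall c, D (k c),
      cancel k h & forall x, D x -> k (h x) = x].

(** Induction on the number of bits that decide membership: [D] is the disjoint
    union of 0 D_0 and 1 D_1, with D_0 and D_1 decided by one bit less.  If one
    of them is empty then [D] is a copy of the other; otherwise both are Cantor
    spaces, and the Cantor space is itself the union of two copies of itself,
    one for each first bit. *)
Lemma cantor_piece_cantor_space (n : nat) (D : cantor_space -> bool) :
  (forall x z, agree n x z -> D z = D x) -> (exists x, D x) -> cantor_piece D.
Proof.
elim: n D => [|n IHn] D Dn [x0 Dx0].
  have DT x : D x by rewrite (Dn x0).
  by exists id, id; split=> // x; exact: cvg_id.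
pose Dcons b x := D (bit_cons b x).
have Dcons_agree b x z : agree n x z -> Dcons b z = Dcons b x.
  by move=> xz; apply: Dn => -[|i] // /xz.
have piece b : (exists x, Dcons b x) -> cantor_piece (Dcons b).
  by apply: IHn => x z; exact: Dcons_agree.
have one_half b :
    ~ (exists x, Dcons (~~ b) x) -> cantor_piece (Dcons b) -> cantor_piece D.
  move=> none [h [k [hcont kcont Dk kK hK]]].
  exists (h \o bit_tail), (bit_cons b \o k); split=> //=.
  - by move=> x; apply: continuous_comp; [exact: bit_tail_continuous|exact: hcont].
  - by move=> x; apply: continuous_comp; [exact: kcont|exact: bit_cons_continuous].
  move=> x Dx; have xb : x 0 = b.
    apply/eqP/negPn/negP => xb; apply: none; exists (bit_tail x).
    have -> : ~~ b = x 0 by move: xb; case: (b); case: (x 0).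
    by rewrite /Dcons bit_consK.
  by rewrite /= hK /Dcons -xb bit_consK.
have [ex1|no1] := pselect (exists x, Dcons true x); last first.
  apply: (one_half false) => //; apply: piece; exists (bit_tail x0).
  case E : (x0 0); last by rewrite /Dcons -E bit_consK.
  by case: no1; exists (bit_tail x0); rewrite /Dcons -E bit_consK.
have [ex0|no0] := pselect (exists x, Dcons false x); last first.
  by apply: (one_half true) => //; exact: piece.
have /choice[h /choice[k hk]] : forall b, cantor_piece (Dcons b).
  by case; exact: piece.
exists (fun x => bit_cons (x 0) (h (x 0) (bit_tail x))),
  (fun c => bit_cons (c 0) (k (c 0) (bit_tail c))); split.
- apply: (continuous_bind (W := fun b x => bit_cons b (h b (bit_tail x)))).
    exact: locally_constant_bit.
  move=> b; have [hcont _ _ _ _] := hk b => x.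
  apply: (continuous_comp (f := h b \o bit_tail)); last exact: bit_cons_continuous.
  by apply: continuous_comp; [exact: bit_tail_continuous|exact: hcont].
- apply: (continuous_bind (W := fun b x => bit_cons b (k b (bit_tail x)))).
    exact: locally_constant_bit.
  move=> b; have [_ kcont _ _ _] := hk b => x.
  apply: (continuous_comp (f := k b \o bit_tail)); last exact: bit_cons_continuous.
  by apply: continuous_comp; [exact: bit_tail_continuous|exact: kcont].
- by move=> c; have [_ _ Dk _ _] := hk (c 0); exact: Dk.
- move=> c; have [_ _ _ kK _] := hk (c 0).
  by rewrite -[RHS]bit_consK -[in RHS](kK (bit_tail c)).
move=> x Dx; have [_ _ _ _ hK] := hk (x 0).
by rewrite -[RHS]bit_consK -[in RHS](hK (bit_tail x)) // /Dcons bit_consK.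
Qed.

Lemma locally_constant_finite_bits (T : Type) (V : cantor_space -> T) :
  locally_constant V -> exists n, forall x z, agree n x z -> V z = V x.
Proof.
move=> Vlc; have /compact_near_coveringP/(_ _ \oo
  (fun n x => forall z, agree n x z -> V z = V x)) := cantor_space_compact.
case=> [x _|n _ nV]; last by exists n => x z; apply: (nV n) => /=.
have [n nV] := cylinder_basis (Vlc x).
exists ([set x' | agree n x x'], [set m | n <= m]).
  by split; [exact: near_agree|exists n].
move=> [x' m] /= [xx' nm] z x'z; rewrite (nV x') // nV // => i i_n.
by rewrite x'z ?xx' // (leq_trans i_n).
Qed.

Lemma clopen_cantor_piece (S : topologicalType) (D : S -> bool) :
  homeomorphic S cantor_space -> locally_constant D -> (exists x, D x) ->
  cantor_piece D.
Proof.
move=> [a [b [acont bcont aK bK]]] Dlc [x0 Dx0].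
have [n Dn] := locally_constant_finite_bits (locally_constant_preimage bcont Dlc).
have [|h [k [hcont kcont Dk kK hK]]] := cantor_piece_cantor_space Dn.
  by exists (a x0); rewrite aK.
exists (h \o a), (b \o k); split=> //=.
- by move=> x; apply: continuous_comp; [exact: acont|exact: hcont].
- by move=> x; apply: continuous_comp; [exact: kcont|exact: bcont].
- by move=> c /=; rewrite bK kK.
by move=> x Dx; rewrite hK ?aK.
Qed.

(** The sets V = t and U = t are nonempty and clopen, hence both Cantor spaces;
    the homeomorphisms between them, one for each [t], are glued together. *)
Lemma homeomorphisms_matching_partitions (X Y : topologicalType) (T : eqType)
    (U : X -> T) (V : Y -> T) :
  homeomorphic X cantor_space -> homeomorphic Y cantor_space ->
  locally_constant U -> locally_constant V ->
  (forall t, exists x, U x = t) -> (forall t, exists y, V y = t) ->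
  exists (psi : Y -> X) (phi : X -> Y),
    inverse_homeomorphisms psi phi /\ forall y, U (psi y) = V y.
Proof.
move=> XC YC Ulc Vlc Usurj Vsurj.
have /choice[hX /choice[kX hkX]] t : cantor_piece (fun x => U x == t).
  apply: clopen_cantor_piece => //.
    exact: (locally_constant_comp (fun u => u == t)).
  by have [x Ux] := Usurj t; exists x; rewrite Ux.
have /choice[hY /choice[kY hkY]] t : cantor_piece (fun y => V y == t).
  apply: clopen_cantor_piece => //.
    exact: (locally_constant_comp (fun v => v == t)).
  by have [y Vy] := Vsurj t; exists y; rewrite Vy.
pose psi y := kX (V y) (hY (V y) y); pose phi x := kY (U x) (hX (U x) x).
have Upsi y : U (psi y) = V y.
  by have [_ _ /(_ (hY (V y) y))/eqP] := hkX (V y).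
have Vphi x : V (phi x) = U x.
  by have [_ _ /(_ (hX (U x) x))/eqP] := hkY (U x).
exists psi, phi; split=> //; split.
- apply: (continuous_bind (W := fun t y => kX t (hY t y))) => // t y.
  have [_ kcont _ _ _] := hkX t; have [hcont _ _ _ _] := hkY t.
  by apply: (continuous_comp (f := hY t)); [exact: hcont|exact: kcont].
- apply: (continuous_bind (W := fun t x => kY t (hX t x))) => // t x.
  have [_ kcont _ _ _] := hkY t; have [hcont _ _ _ _] := hkX t.
  by apply: (continuous_comp (f := hX t)); [exact: hcont|exact: kcont].
- move=> y; rewrite {1}/phi Upsi /psi.
  have [_ _ _ -> _] := hkX (V y); have [_ _ _ _ -> //] := hkY (V y).
move=> x; rewrite {1}/psi Vphi /phi.
have [_ _ _ -> _] := hkY (U x); have [_ _ _ _ -> //] := hkX (U x).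
Qed.

(** * Walks in graphs *)

(** Walks are functions of time, restricted by nothing outside [0 <= i <= l], so
    that they are concatenated and shifted without dependent lengths. *)
Definition walk (T : Type) (e : T -> T -> Prop) (u v : T) (l : nat)
    (w : nat -> T) :=
  [/\ w 0 = u, w l = v & forall i, i < l -> e (w i) (w i.+1)].

Lemma walk_cat (T : Type) (e : T -> T -> Prop) (u v s : T) (l m : nat)
    (w1 w2 : nat -> T) : walk e u v l w1 -> walk e v s m w2 ->
  walk e u s (l + m) (fun i => if i < l then w1 i else w2 (i - l)).
Proof.
move=> [w10 w1l w1e] [w20 w2m w2e]; split.
- case: ltnP => //; rewrite leqn0 => /eqP l0.
  by rewrite sub0n w20 -w1l l0.
- by rewrite ltnNge leq_addr /= addnC addnK.
move=> i ilm; case: (ltnP i.+1 l) => [il|li].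
  by rewrite (ltnW il); exact: w1e (ltnW il).
case: ltnP => [il|li'].
  have <- : i.+1 = l by apply/eqP; rewrite eqn_leq li il.
  rewrite subnn w20 -w1l; have -> : l = i.+1 by apply/eqP; rewrite eqn_leq li il.
  exact: w1e.
by rewrite subSn //; apply: w2e; rewrite ltn_subLR.
Qed.

(** The time [l] is excluded, since the vertex met at that time is the first
    vertex of the next walk when walks are placed end to end. *)
Definition covering_walk (T : finType) (e : T -> T -> Prop) (u v : T) (l : nat)
    (w : nat -> T) :=
  walk e u v l w /\ forall t, exists2 i, i < l & w i = t.

(** A walk through the vertices of a list spends a fixed time [N] between
    consecutive ones, and all the remaining time on the last stretch. *)
Lemma exists_covering_walk (T : finType) (e : T -> T -> Prop) (N : nat) :
  0 < N -> (forall u v l, N <= l -> exists w, walk e u v l w) ->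
  exists2 L, 0 < L & forall u v l, L <= l -> exists w, covering_walk e u v l w.
Proof.
move=> N0 Nwalk.
suff cover (s : seq T) u v l : N * (size s).+1 <= l ->
    exists2 w, walk e u v l w & forall t, t \in s -> exists2 i, i < l & w i = t.
  exists (N * (size (enum T)).+1); first by rewrite muln_gt0 N0.
  move=> u v l /cover-/(_ u v)[w ww cw]; exists w; split=> // t.
  by apply: cw; rewrite mem_enum.
elim: s u l => [|t s IHs] u l.
  by rewrite muln1 => /(Nwalk u v)[w ww]; exists w.
rewrite [size _]/= mulnS => Nl.
have Nl' : N <= l := leq_trans (leq_addr _ _) Nl.
have [w1 w1w] := Nwalk u t N (leqnn N).
have [|w2 w2w w2s] := IHs t (l - N); first by rewrite leq_subRL.
exists (fun i => if i < N then w1 i else w2 (i - N)).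
  by rewrite -(subnKC Nl'); exact: walk_cat w1w w2w.
move=> t'; rewrite inE => /predU1P[->|/w2s[i il <-]].
  exists N; last by rewrite ltnn subnn; case: w2w.
  by apply: leq_trans Nl; rewrite -addn1 leq_add2l muln_gt0 N0.
exists (N + i); first by rewrite -ltn_subRL.
by rewrite ltnNge leq_addr /= addnC addnK.
Qed.

(** * First hitting times *)

Lemma find_iotaP (P : pred nat) (B : nat) : (exists2 i, i < B & P i) ->
  P (find P (iota 0 B)) /\ forall j, j < find P (iota 0 B) -> ~~ P j.
Proof.
move=> [i iB Pi]; have hasP : has P (iota 0 B).
  by apply/hasP; exists i => //; rewrite mem_iota.
have fB := hasP; rewrite has_find size_iota in fB.
split; first by have := nth_find 0 hasP; rewrite nth_iota.
move=> j jf; have := before_find 0 jf.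
by rewrite nth_iota ?add0n ?(ltn_trans jf) // => ->.
Qed.

Lemma find_iota_eq (P : pred nat) (B n : nat) : (exists2 i, i < B & P i) ->
  P n -> (forall j, j < n -> ~~ P j) -> find P (iota 0 B) = n.
Proof.
move=> /find_iotaP[]; set m := find _ _ => Pm m_min Pn n_min.
apply/eqP; rewrite eqn_leq (leqNgt m) (leqNgt n); apply/andP; split; apply/negP.
  by move=> /m_min; rewrite Pn.
by move=> /n_min; rewrite Pm.
Qed.

Section Iterates.
Context {Y : Type} (g gi : Y -> Y) (gK : cancel g gi).

Lemma iter_cancel_le (i j : nat) (y : Y) : i <= j ->
  iter i gi (iter j g y) = iter (j - i) g y.
Proof.
elim: i j => [|i IHi] [|j] // ij.
by rewrite iterSr iterS gK subSS IHi.
Qed.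

Lemma iter_cancel_ge (i j : nat) (y : Y) : j <= i ->
  iter i gi (iter j g y) = iter (i - j) gi y.
Proof.
by move=> ji; rewrite -{1}(subnK ji) iterD iter_cancel_le // subnn.
Qed.

Lemma iter_period (p j : nat) (y : Y) : iter p g y = y -> iter (p * j) g y = y.
Proof. by move=> py; elim: j => [|j IHj]; rewrite ?muln0 // mulnS iterD IHj. Qed.

End Iterates.

Lemma locally_constant_iter (Y : topologicalType) (T : Type) (V : Y -> T)
    (h : Y -> Y) (i : nat) : continuous h -> locally_constant V ->
  locally_constant (fun y => V (iter i h y)).
Proof.
move=> hcont; apply: locally_constant_preimage; exact: continuous_iter.
Qed.

(** * Interpolation between anchors *)

(** Let [A] be a clopen set (of anchors) that every orbit meets within bounded
    time, in the past and in the future.  A labelling [c] of the anchors extends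
    to all points if a walk of the right length is chosen between the labels of
    consecutive anchors of an orbit: a point is labelled by the walk that goes
    from its last anchor to its next one, read at the time elapsed since the
    last anchor.  The bound on the hitting times makes the label depend on a
    bounded piece of the orbit only, hence locally constant. *)
Section Anchors.
Context {Y : topologicalType} (g gi : Y -> Y).
Hypotheses (gcont : continuous g) (gicont : continuous gi).
Hypotheses (gK : cancel g gi) (giK : cancel gi g).
Context (T : Type) (e : T -> T -> Prop) (A : Y -> bool) (B : nat) (c : Y -> T).
Context (w : T -> T -> nat -> nat -> T).
Hypotheses (Alc : locally_constant A) (clc : locally_constant c).
Hypothesis past_anchor : forall y, exists2 i, i < B & A (iter i gi y).
Hypothesis future_anchor : forall y, exists2 i, i < B & A (iter i g y).

Definition consecutive_anchors y r := [/\ 0 < r, A y, A (iter r g y) &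
  forall j, 0 < j < r -> ~~ A (iter j g y)].

Hypothesis wwalk : forall y r, consecutive_anchors y r ->
  walk e (c y) (c (iter r g y)) r (w (c y) (c (iter r g y)) r).

(* Points of [A] are their own last anchor, but not their own next anchor. *)
Let past y := find (fun i => A (iter i gi y)) (iota 0 B).
Let future y := find (fun i => A (iter i g (g y))) (iota 0 B).

Let interpolation y :=
  let s := past y in let t := (future y).+1 in
  w (c (iter s gi y)) (c (iter t g y)) (s + t) s.

Lemma interpolation_locally_constant : locally_constant interpolation.
Proof.
apply: (locally_constant_bind (V := past) (W := fun s y =>
  let t := (future y).+1 in
  w (c (iter s gi y)) (c (iter t g y)) (s + t) s)).
  by apply: locally_constant_find => i; exact: locally_constant_iter.
move=> s; apply: (locally_constant_bind (V := future) (W := fun t y =>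
  w (c (iter s gi y)) (c (iter t.+1 g y)) (s + t.+1) s)).
  apply: (locally_constant_find (P := fun i y => A (iter i g (g y)))) => i.
  apply: (locally_constant_preimage (V := fun y => A (iter i g y))) => //.
  exact: locally_constant_iter.
move=> t; apply: (locally_constant_comp2 (fun u v => w u v (s + t.+1) s)).
  exact: locally_constant_iter.
exact: (locally_constant_iter t.+1).
Qed.

Lemma interpolation_walk y r j : consecutive_anchors y r -> j < r ->
  interpolation (iter j g y) = w (c y) (c (iter r g y)) r j.
Proof.
move=> [r0 Ay Ar gap] jr; rewrite /interpolation.
have -> : past (iter j g y) = j.
  apply: find_iota_eq => [//||i ij].
    by rewrite iter_cancel_le // subnn.
  rewrite iter_cancel_le ?(ltnW ij) //; apply: gap.
  by rewrite subn_gt0 ij (leq_ltn_trans (leq_subr _ _)).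
have -> : (future (iter j g y)).+1 = r - j.
  rewrite -[RHS]prednK ?subn_gt0 //; congr S.
  apply: find_iota_eq => [//||i ij].
    by rewrite -iterSr prednK ?subn_gt0 // -iterD subnK // ltnW.
  rewrite -iterSr -iterD; apply: gap; rewrite addSn /=.
  by rewrite -ltnS prednK ?subn_gt0 // in ij; rewrite -addSn addnC -ltn_subRL.
by rewrite iter_cancel_le // subnn -iterD subnK ?(ltnW jr) // subnKC // ltnW.
Qed.

Lemma exists_consecutive_anchors y : exists a r j,
  [/\ consecutive_anchors a r, j < r & y = iter j g a].
Proof.
have [Ap pmin] := find_iotaP (past_anchor y).
have [Af fmin] := find_iotaP (future_anchor (g y)).
rewrite -/(past y) in Ap pmin; rewrite -/(future y) in Af fmin.
exists (iter (past y) gi y), (past y + (future y).+1), (past y).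
have back j : past y <= j ->
    iter j g (iter (past y) gi y) = iter (j - past y) g y.
  by move=> pj; rewrite (iter_cancel_ge giK).
split; last by rewrite back // subnn.
  split=> //; first by rewrite addnS.
    by rewrite back ?leq_addr // addKn iterSr.
  move=> j /andP[j0 jpf]; case: (ltnP j (past y)) => [jp|pj].
    rewrite (iter_cancel_le giK) ?(ltnW jp) //; apply: pmin.
    by rewrite ltn_subrL j0 (leq_trans _ jp).
  move: pj; rewrite leq_eqVlt => /predU1P[pj|pj].
    rewrite -pj back // subnn; apply: (pmin 0); by rewrite pj.
  rewrite back ?(ltnW pj) //.
  move: jpf; rewrite -ltn_subLR ?(ltnW pj) //.
  have : 0 < j - past y by rewrite subn_gt0.
  by case: (j - past y) => // k _ /fmin; rewrite iterSr.
by rewrite -addn1 leq_add2l.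
Qed.

(** Inside a walk this is the edge of the walk.  At its end, the next point is
    an anchor, labelled by the start of another walk, which is by hypothesis the
    end of the previous one. *)
Lemma interpolation_edge y : e (interpolation y) (interpolation (g y)).
Proof.
have [a [r [j [ar jr ->]]]] := exists_consecutive_anchors y.
have [w0 wr we] := wwalk ar.
rewrite (interpolation_walk ar jr) -iterS.
have [j1r|rj1] := ltnP j.+1 r.
  by rewrite (interpolation_walk ar j1r); exact: we.
have {rj1 jr} rE : r = j.+1 by apply/eqP; rewrite eqn_leq rj1 jr.
rewrite -rE; have [_ _ Ar _] := ar.
have [b [q [[|i] [bq iq E]]]] := exists_consecutive_anchors (iter r g a).
  have [w0' _ _] := wwalk bq.
  have -> : interpolation (iter r g a) = c (iter r g a).
    by rewrite E (interpolation_walk bq iq).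
  by have := we j; rewrite -rE wr; apply.
by have [_ _ _ /(_ i.+1 iq)] := bq; rewrite -E Ar.
Qed.

Lemma interpolate_anchors : exists V : Y -> T,
  [/\ locally_constant V, forall y, e (V y) (V (g y)) &
    forall y r j, consecutive_anchors y r -> j < r ->
      V (iter j g y) = w (c y) (c (iter r g y)) r j].
Proof.
exists interpolation; split; first exact: interpolation_locally_constant.
  exact: interpolation_edge.
exact: interpolation_walk.
Qed.

End Anchors.

(** * Markers *)

Definition totally_separated (Y : topologicalType) :=
  forall a b : Y, a <> b ->
    exists2 D : Y -> bool, locally_constant D & D a /\ ~~ D b.

Lemma cantor_totally_separated (Y : topologicalType) :
  homeomorphic Y cantor_space -> totally_separated Y.
Proof.
move=> [h [k [hcont _ hK _]]] a b ab.
have [i hi] : exists i, h a i <> h b i.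
  by apply/existsNP => E; apply: ab; rewrite -(hK a) -(hK b); congr k; apply/funext.
exists (fun y => h y i == h a i).
  apply: (locally_constant_comp (fun x => x == h a i)).
  exact: locally_constant_preimage hcont (locally_constant_bit i).
by rewrite eqxx; split=> //; apply/eqP => /esym.
Qed.

Definition no_return (Y : Type) (g : Y -> Y) (n : nat) (D : Y -> bool) :=
  forall y i, 0 < i < n -> D y -> ~~ D (iter i g y).

(** If [E] is a clopen set that contains [y] but not [g^i y], then the set of
    the points [z] of [E] with [g^i z] outside [E] does not return to itself at
    time [i]; intersect these neighbourhoods of [y] over the times [i]. *)
Lemma exists_no_return_nbhd (Y : topologicalType) (g : Y -> Y) (n : nat) (y : Y) :
  totally_separated Y -> continuous g ->
  (forall i, 0 < i < n -> iter i g y <> y) ->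
  exists2 D : Y -> bool, locally_constant D & D y /\ no_return g n D.
Proof.
move=> Ysep gcont; elim: n => [_|n IHn yn].
  exists (fun=> true); first exact: locally_constant_cst.
  by split=> // z i /andP[].
have [|D Dlc [Dy Dn]] := IHn.
  by move=> i /andP[i0 il]; apply: yn; rewrite i0 ltnW.
have [->|n0] := posnP n.
  exists D => //; split=> // z i /andP[i0].
  by rewrite ltnS leqNgt i0.
have [E Elc [Ey /negbTE Eny]] : exists2 E : Y -> bool, locally_constant E &
    E y /\ ~~ E (iter n g y).
  by apply: Ysep => /esym; apply: yn; rewrite n0 /=.
exists (fun z => D z && (E z && ~~ E (iter n g z))).
  apply: locally_constant_comp2 => //; apply: locally_constant_comp2 => //.
  apply: (locally_constant_comp negb (V := fun z => E (iter n g z))).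
  exact: locally_constant_iter.
rewrite Dy Ey Eny; split=> // z i /andP[i0].
rewrite ltnS leq_eqVlt => /predU1P[->|i_n] /and3P[Dz Ez /negbTE nEz].
  by rewrite nEz andbF.
by rewrite negb_and Dn ?i0.
Qed.

(** In terms of orbits, [F] is a set of marked times, and [marked y] says that
    some marked time is at distance less than [L] from the time of [y]. *)
Section Markers.
Context {Y : Type} (g gi : Y -> Y) (F : Y -> bool) (L : nat).

Definition marked y := has (fun i => F (iter i g y) || F (iter i gi y)) (iota 0 L).

Lemma markedP y :
  reflect (exists2 i, i < L & F (iter i g y) || F (iter i gi y)) (marked y).
Proof.
apply: (iffP hasP) => -[i]; rewrite ?mem_iota ?add0n => iL Fi.
  by exists i => //; case/andP: iL.
by exists i => //; rewrite mem_iota.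
Qed.

End Markers.

Lemma marked_locally_constant (Y : topologicalType) (g gi : Y -> Y)
    (F : Y -> bool) (L : nat) :
  continuous g -> continuous gi -> locally_constant F ->
  locally_constant (marked g gi F L).
Proof.
move=> gcont gicont Flc.
apply: (locally_constant_has (P := fun i z => F (iter i g z) || F (iter i gi z))).
by move=> i; apply: locally_constant_comp2; exact: locally_constant_iter.
Qed.

(** Greedy choice: the points of a further clopen set become markers unless a
    marker is already present at distance less than [L] in their orbit.  As the
    new set does not return to itself before time [L] either, markers stay at
    distance at least [L], and each point treated is a marker or close to one. *)
Lemma exists_markers (Y : topologicalType) (g gi : Y -> Y) (L : nat)
    (D : Y -> Y -> bool) (s : seq Y) :
  continuous g -> continuous gi -> cancel g gi -> cancel gi g -> 0 < L ->
  (forall y, y \in s -> locally_constant (D y) /\ no_return g L (D y)) ->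
  exists2 F : Y -> bool, locally_constant F & no_return g L F /\
    forall y z, y \in s -> D y z -> marked g gi F L z.
Proof.
move=> gcont gicont gK giK L0; elim: s => [_|y s IHs sD].
  by exists (fun=> false) => //; exact: locally_constant_cst.
have [|F Flc [Fn Fs]] := IHs.
  by move=> z zs; apply: sD; rewrite inE zs orbT.
have [Dlc Dn] := sD y (mem_head _ _).
exists (fun z => F z || (D y z && ~~ marked g gi F L z)).
  apply: locally_constant_comp2 => //; apply: locally_constant_comp2 => //.
  exact: (locally_constant_comp negb (marked_locally_constant _ _ _ _)).
split=> [z i iL|x z].
  have [i0 iL'] := andP iL.
  case/orP=> [Fz|/andP[Dz nFz]]; rewrite negb_or.
    rewrite (Fn _ _ iL Fz) negb_and negbK orbC; apply/orP; left.
    apply/markedP; exists i => //.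
    by rewrite (iter_cancel_le gK) // subnn Fz orbT.
  rewrite (negbTE (Dn _ _ iL Dz)) /= andbT; apply/negP => Fi.
  by move/markedP: nFz; apply; exists i; rewrite ?Fi.
have weaken : marked g gi F L z ->
    marked g gi (fun z => F z || (D y z && ~~ marked g gi F L z)) L z.
  by case/markedP=> i iL Fi; apply/markedP; exists i => //;
    case/orP: Fi => ->; rewrite ?orbT.
rewrite inE => /predU1P[->|xs] Dxz; last by apply: weaken; exact: Fs Dxz.
have [/weaken //|nM] := boolP (marked g gi F L z).
by apply/markedP; exists 0; rewrite //= Dxz nM orbT.
Qed.

(** * Labellings from markers *)

(** Anchors are the points whose label is kept: the markers, and the points at
    distance at least [L] from every marker of their orbit. *)
Definition anchor (Y : Type) (g gi : Y -> Y) (F : Y -> bool) (L : nat) y :=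
  F y || ~~ marked g gi F L y.

Section MarkedLabelling.
Context {Y : topologicalType} (g gi : Y -> Y).
Hypotheses (gcont : continuous g) (gicont : continuous gi).
Hypotheses (gK : cancel g gi) (giK : cancel gi g).
Context (F : Y -> bool) (L : nat).
Hypotheses (L0 : 0 < L) (Flc : locally_constant F) (Fn : no_return g L F).

Lemma anchor_locally_constant : locally_constant (anchor g gi F L).
Proof.
apply: locally_constant_comp2 => //.
exact: (locally_constant_comp negb (marked_locally_constant _ _ _ _)).
Qed.

(** Two markers are at distance at least [L], and so are by definition a marker
    and an unmarked anchor.  After an unmarked anchor, the next point can only
    fail to be an anchor because a marker comes exactly [L] steps after the
    anchor, and then no unmarked anchor comes before that marker. *)
Lemma consecutive_anchors_gap y r : consecutive_anchors g (anchor g gi F L) y r ->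
  L <= r \/ r = 1 /\ ~~ marked g gi F L y.
Proof.
move=> [r0 Ay Ar gap]; have [|rL] := leqP L r; [by left|right].
have [Fy|nFy] := boolP (F y).
  exfalso; have := Fn _ Fy; move: Ar; rewrite /anchor => /orP[Fr /(_ r)|nM _].
    by rewrite r0 rL Fr => /(_ isT).
  move/markedP: nM; apply; exists r => //.
  by rewrite (iter_cancel_le gK) // subnn Fy orbT.
move: Ay; rewrite /anchor (negbTE nFy) /= => nMy; split=> //.
have nMr : ~~ marked g gi F L (iter r g y).
  move: Ar; rewrite /anchor => /orP[Fr|//].
  by exfalso; move/markedP: nMy; apply; exists r => //; rewrite Fr.
apply/eqP; rewrite eqn_leq r0 andbT leqNgt; apply/negP => r1.
have := gap 1; rewrite r1 /anchor negb_or negbK => /(_ isT)/andP[/= nFgy].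
move=> /markedP[i iL]; rewrite -iterSr => /orP[Fi|].
  have [iL1|Li] := ltnP i.+1 L.
    by move/markedP: nMy; apply; exists i.+1 => //; rewrite Fi.
  move/markedP: nMr; apply; exists (L - r); first by rewrite ltn_subrL r0.
  rewrite -iterD subnK ?(ltnW rL) //.
  have <- : i.+1 = L by apply/eqP; rewrite eqn_leq iL Li.
  by rewrite Fi.
case: i iL => [|i] iL; first by rewrite /= (negbTE nFgy).
rewrite iterSr gK => Fi; move/markedP: nMy; apply; exists i; first exact: ltnW.
by rewrite Fi orbT.
Qed.

End MarkedLabelling.

(** If [y] is close to a marker [m] that lies in its past (otherwise there is
    nothing to prove), consider the point [g^L m].  Either it is an anchor, or
    it is close to a marker, which comes after [m] by at least [L] steps since
    markers are at distance at least [L]; hence this marker lies in the future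
    of [y], at distance less than [2 * L]. *)
Lemma anchor_recurrence (Y : Type) (g gi : Y -> Y) (F : Y -> bool) (L : nat) y :
  cancel g gi -> cancel gi g -> 0 < L -> no_return g L F ->
  exists2 i, i < 2 * L & anchor g gi F L (iter i g y).
Proof.
move=> gK giK L0 Fn.
have L2 : L <= 2 * L by rewrite leq_pmull.
have [|nM] := boolP (marked g gi F L y); last first.
  by exists 0; [exact: leq_trans L0 L2 | rewrite /anchor /= nM orbT].
move=> /markedP[i iL /orP[Fi|Fi]].
  by exists i; [exact: leq_trans iL L2 | rewrite /anchor Fi].
have [i0|i0] := posnP i.
  by exists 0; [exact: leq_trans L0 L2 | move: Fi; rewrite i0 /anchor => ->].
have [|nM] := boolP (marked g gi F L (iter (L - i) g y)); last first.
  exists (L - i); last by rewrite /anchor nM orbT.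
  by apply: leq_trans L2; rewrite ltn_subrL i0.
move=> /markedP[k kL /orP[Fk|]].
  exists (k + (L - i)); last by rewrite iterD /anchor Fk.
  by rewrite mul2n -addnn -addSn leq_add // leq_subr.
have -> : iter (L - i) g y = iter L g (iter i gi y).
  by rewrite (iter_cancel_ge giK) // ltnW.
rewrite (iter_cancel_le gK) ?(ltnW kL) // => Fk.
have [k0|k0] := posnP k.
  exists (L - i); first by apply: leq_trans L2; rewrite ltn_subrL i0.
  by rewrite -(iter_cancel_ge giK) ?(ltnW iL) // /anchor; move: Fk; rewrite k0 subn0 => ->.
have := Fn _ (L - k) _ Fi; rewrite Fk subn_gt0 kL ltn_subrL k0 L0.
by move=> /(_ isT).
Qed.

Lemma no_return_inverse (Y : Type) (g gi : Y -> Y) (F : Y -> bool) (L : nat) :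
  cancel gi g -> no_return g L F -> no_return gi L F.
Proof.
move=> giK Fn y i iL Fy; apply/negP => Fi.
by have := Fn _ _ iL Fi; rewrite (iter_cancel_le giK) // subnn Fy.
Qed.

Lemma anchor_inverse (Y : Type) (g gi : Y -> Y) (F : Y -> bool) (L : nat) y :
  anchor gi g F L y = anchor g gi F L y.
Proof.
by rewrite /anchor /marked; congr (_ || ~~ _); apply: eq_has => i; rewrite orbC.
Qed.

(** Interpolation between the anchors, each of which keeps the label [V0].  Two
    consecutive anchors are joined by a covering walk when they are at distance
    at least [L]; otherwise they are unmarked and consecutive in time, and the
    hypothesis on [V0] is the required edge.  A marker is always followed by a
    covering walk, hence all labels are taken. *)
Lemma labelling_from_markers (Y : topologicalType) (g gi : Y -> Y) (T : finType)
    (e : T -> T -> Prop) (L : nat) (F : Y -> bool) (V0 : Y -> T) :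
  continuous g -> continuous gi -> cancel g gi -> cancel gi g -> 0 < L ->
  (forall u v l, L <= l -> exists w, covering_walk e u v l w) ->
  locally_constant F -> no_return g L F -> (exists y, F y) ->
  locally_constant V0 ->
  (forall y, ~~ marked g gi F L y -> e (V0 y) (V0 (g y))) ->
  exists V : Y -> T, [/\ locally_constant V, forall y, e (V y) (V (g y)) &
    forall t, exists y, V y = t].
Proof.
move=> gcont gicont gK giK L0 covering Flc Fn [y1 Fy1] V0lc V0e.
have /choice[w wP] (x : T * T * nat) : exists w,
    (L <= x.2 -> covering_walk e x.1.1 x.1.2 x.2 w) /\
    (x.2 = 1 -> e x.1.1 x.1.2 -> walk e x.1.1 x.1.2 x.2 w).
  case: x => [[u v] l] /=; have [Ll|lL] := leqP L l.
    by have [w [ww wc]] := covering u v _ Ll; exists w.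
  exists (fun i => if i is 0 then u else v); split=> // -> euv.
  by split=> // -[].
have [|//||||V [Vlc Ve Vw]] := @interpolate_anchors _ _ _ gcont gicont gK giK
  _ e (anchor g gi F L) (2 * L) V0 (fun u v l => w (u, v, l)).
- exact: anchor_locally_constant.
- move=> y.
  have [i iL Ai] := anchor_recurrence y giK gK L0 (no_return_inverse giK Fn).
  by exists i => //; rewrite -anchor_inverse.
- by move=> y; exact: anchor_recurrence.
- move=> y r yr; have [wlong wshort] := wP (V0 y, V0 (iter r g y), r).
  have [/wlong[]//|[r1 nMy]] := consecutive_anchors_gap gK L0 Fn yr.
  by apply: wshort => //=; rewrite r1 /=; exact: V0e.
exists V; split=> // t.
(* The anchor that follows the marker [y1] comes at time [r.+1]. *)
have [Pr r_min] := find_iotaP (anchor_recurrence (g y1) gK giK L0 Fn).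
set r := find _ _ in Pr r_min.
have y1r : consecutive_anchors g (anchor g gi F L) y1 r.+1.
  split=> //; first by rewrite /anchor Fy1.
    by rewrite iterSr.
  by case=> // j /andP[_]; rewrite iterSr ltnS; exact: r_min.
have Lr : L <= r.+1.
  have [//|[_ /markedP[]]] := consecutive_anchors_gap gK L0 Fn y1r.
  by exists 0 => //=; rewrite Fy1.
have [/(_ Lr)[_ /(_ t)[i ir <-]] _] := wP (V0 y1, V0 (iter r.+1 g y1), r.+1).
by exists (iter i g y1); rewrite (Vw _ _ _ y1r).
Qed.

(** * Labelling the points of low period *)

(** The mixed cases are false: the domain of a partial labelling has to be
    invariant. *)
Definition option_rel (T : Type) (e : T -> T -> Prop) (a b : option T) :=
  match a, b with
  | Some u, Some v => e u v
  | None, None => True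
  | _, _ => False
  end.

(** Take a clopen neighbourhood [D] of [y] which does not return to itself
    before time [p], and let [E] be the part of [D] that stays in [D] under the
    first [M] iterates of [g^p].  On the points fixed by [g^M], the set [E] is
    invariant under [g^p] and disjoint from its images at the times 0 < i < p:
    its images form a tower of [p] floors on which [g] moves cyclically.  The
    floors are labelled by the closed walk, read off from the time left before
    the next visit to [E]. *)
Lemma periodic_orbit_labelling (Y : topologicalType) (g : Y -> Y) (T : Type)
    (e : T -> T -> Prop) (M p : nat) (y : Y) (u : T) (w : nat -> T) :
  totally_separated Y -> continuous g -> 0 < M -> 0 < p ->
  iter p g y = y -> (forall i, 0 < i < p -> iter i g y <> y) ->
  walk e u u p w ->
  exists2 V : Y -> option T, locally_constant V & V y /\
    forall x, iter M g x = x -> option_rel e (V x) (V (g x)).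
Proof.
move=> Ysep gcont M0 p0 py ymin [w0 wp we].
have [D Dlc [Dy Dret]] := exists_no_return_nbhd Ysep gcont ymin.
pose E x := all (fun j => D (iter (p * j) g x)) (iota 0 M).
have EP x : reflect (forall j, j < M -> D (iter (p * j) g x)) (E x).
  apply: (iffP allP) => H j; first by move=> jM; apply: H; rewrite mem_iota.
  by rewrite mem_iota add0n => /andP[_]; exact: H.
have Elc : locally_constant E.
  apply: (locally_constant_all (P := fun j x => D (iter (p * j) g x))) => j.
  exact: locally_constant_iter.
have ED x : E x -> D x by move=> /EP/(_ 0 M0); rewrite muln0.
have Eret x i : 0 < i < p -> E x -> ~~ E (iter i g x).
  by move=> ip /ED Dx; apply: contra (Dret _ _ ip Dx); exact: ED.
have Ey : E y by apply/EP => j _; rewrite iter_period.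
have Eper x : iter M g x = x -> E (iter p g x) = E x.
  move=> Mx; have pMx : iter (p * M) g x = x by rewrite mulnC iter_period.
  apply/EP/EP => H j jM.
    case: j jM => [|j] jM; last by rewrite mulnS addnC iterD; apply: H; exact: ltnW.
    rewrite muln0 /=; have := H M.-1; rewrite -iterD -mulnSr prednK // pMx.
    by apply.
  rewrite -iterD -mulnSr; have [jM'|] := ltnP j.+1 M; first exact: H.
  move=> Mj; have -> : j.+1 = M by apply/eqP; rewrite eqn_leq jM Mj.
  by rewrite pMx; have := H 0 M0; rewrite muln0.
(* The value [p] stands for the absence of a visit. *)
pose hit x := find (fun i => E (iter i g x)) (iota 0 p).
exists (fun x => if (hit x < p) then Some (w (p - hit x)) else None).
  apply: (locally_constant_comp (fun h => if h < p then Some (w (p - h)) else None)).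
  apply: (locally_constant_find (P := fun i x => E (iter i g x))) => i.
  exact: locally_constant_iter.
have hitP x : hit x < p -> exists2 i, i < p & E (iter i g x).
  rewrite -{1}(size_iota 0 p) -has_find => /hasP[i]; rewrite mem_iota add0n.
  by move=> /andP[_ ip] Ei; exists i.
have hit_eq x n : n < p -> E (iter n g x) ->
    (forall j, j < n -> ~~ E (iter j g x)) -> hit x = n.
  by move=> np En nmin; apply: find_iota_eq => //; exists n.
split; first by rewrite (hit_eq y 0) // p0.
move=> x Mx; have [hxp|hxp] := ltnP (hit x) p.
  have [] := find_iotaP (hitP x hxp); rewrite -/(hit x).
  case hxE : (hit x) hxp => [|h] hp Eh hmin.
    rewrite (hit_eq (g x) p.-1).
    - rewrite prednK // leqnn subn0 wp -w0 /=.
      have -> : (p - p.-1 = 1) by rewrite -{1}(prednK p0) subSnn.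
      exact: we.
    - by rewrite prednK.
    - by rewrite -iterSr prednK // Eper.
    move=> j jp; rewrite -iterSr; apply: Eret => //=.
    by rewrite -ltnS prednK in jp.
  rewrite (hit_eq (g x) h) ?(ltnW hp) //=.
  - by rewrite -(subnSK (ltnW hp)); apply: we; rewrite ltn_subrL.
  - by rewrite -iterSr.
  by move=> j jh; rewrite -iterSr; exact: hmin.
have noE i : i < p -> ~~ E (iter i g x).
  move=> ip; apply/negP => Ei; move: hxp; rewrite leqNgt => /negP; apply.
  rewrite -(size_iota 0 p) -has_find; apply/hasP; exists i => //.
  by rewrite mem_iota.
case: ltnP => // /[dup] /hitP[i ip]; rewrite -iterSr => Ei _.
have [ip'|pi] := ltnP i.+1 p; first by rewrite (negbTE (noE _ ip')) in Ei.
have pE : i.+1 = p by apply/eqP; rewrite eqn_leq ip pi.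
by have := noE 0 p0; rewrite /= -(Eper _ Mx) -pE Ei.
Qed.

Lemma locally_constant_closed (S : topologicalType) (D : S -> bool) :
  locally_constant D -> closed [set x | D x].
Proof.
move=> Dlc; rewrite -[X in closed X]setCK; apply: open_closedC.
rewrite (_ : ~` _ = [set x | ~~ D x]).
  exact: locally_constant_open (locally_constant_comp negb Dlc).
by apply/seteqP; split=> x /= /negP.
Qed.

Lemma not_fixed_nbhd (Y : topologicalType) (h : Y -> Y) (y : Y) :
  totally_separated Y -> continuous h -> h y <> y ->
  exists2 E : Y -> bool, locally_constant E & E y /\ forall z, E z -> h z <> z.
Proof.
move=> Ysep hcont hy.
have [D Dlc [Dy nDhy]] : exists2 D : Y -> bool, locally_constant D &
    D y /\ ~~ D (h y) by apply: Ysep => /esym.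
exists (fun z => D z && ~~ D (h z)).
  apply: locally_constant_comp2 => //.
  apply: (locally_constant_comp negb (V := fun z => D (h z))).
  exact: locally_constant_preimage.
by rewrite Dy nDhy; split=> // z /andP[Dz nDhz] hz; rewrite hz Dz in nDhz.
Qed.

(** The domains of the partial labellings around the periodic orbits are
    invariant and cover the set fixed by [g^M]; by compactness finitely many
    suffice, and each point takes the first label defined at it.  A point and
    its image use the same partial labelling. *)
Lemma periodic_labelling (Y : topologicalType) (g : Y -> Y) (T : Type)
    (e : T -> T -> Prop) (M : nat) (t0 : T) :
  compact [set: Y] -> totally_separated Y -> continuous g -> 0 < M ->
  (forall n, Per g n -> exists u w, walk e u u n w) ->
  exists2 V : Y -> T, locally_constant V &
    forall x, iter M g x = x -> e (V x) (V (g x)).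
Proof.
move=> Ycompact Ysep gcont M0 gper.
pose Q := [set y | iter M g y = y].
have Qclosed : closed Q.
  rewrite -[Q]setCK; apply: open_closedC; rewrite openE => y Qy.
  have [E Elc [Ey EQ]] := not_fixed_nbhd Ysep (continuous_iter (n := M) gcont) Qy.
  by apply: filterS (Elc y) => z Ez; apply: EQ; rewrite Ez.
have /choice[V Vy] (y : Y) : exists V : Y -> option T, Q y ->
    locally_constant V /\ V y /\
    forall x, iter M g x = x -> option_rel e (V x) (V (g x)).
  have [Qy|nQy] := pselect (Q y); last by exists (fun=> None).
  have exp : exists p, (0 < p) && `[< iter p g y = y >].
    by exists M; rewrite M0; apply/asboolP.
  case: (ex_minnP exp) => p /andP[p0 /asboolP py] pmin.
  have [|u [w uw]] := gper p; first by split=> //; exists y.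
  have [i /andP[i0 ip] iy|V Vlc [Vy Ve]] :=
    periodic_orbit_labelling Ysep gcont M0 p0 py _ uw.
    have := pmin i; rewrite i0 leqNgt ip /= => pmin'.
    by have /pmin' : `[< iter i g y = y >] by apply/asboolP.
  by exists V.
have [y Qy|s sQ scover] := finite_locally_constant_cover
    (D := fun y z => isSome (V y z)) Ycompact Qclosed.
  have [Vlc [Vyy _]] := Vy y Qy; split=> //.
  exact: (locally_constant_comp isSome).
have [W Wlc [We Wcover]] : exists2 W : Y -> option T, locally_constant W &
    (forall x, Q x -> option_rel e (W x) (W (g x))) /\
    forall y x, y \in s -> V y x -> W x.
  elim: s sQ {scover} => [|y s IHs] sQ.
    by exists (fun=> None); first exact: locally_constant_cst.
  have [z zs|W Wlc [We Wcover]] := IHs; first by apply: sQ; rewrite inE zs orbT.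
  have [Vlc [_ Ve]] := Vy _ (sQ y (mem_head _ _)).
  exists (fun x => if V y x is Some t then Some t else W x).
    exact: (locally_constant_comp2
      (fun v v' => if v is Some t then Some t else v')).
  split=> [x Qx|z x].
    by move: (Ve x Qx); case: (V y x) (V y (g x)) => [t|] [t'|] //= _; exact: We.
  rewrite inE => /predU1P[->|/Wcover/[apply]]; first by case: (V y x).
  by case: (V y x).
exists (fun x => odflt t0 (W x)); first exact: locally_constant_comp.
move=> x Mx; have cover z : Q z -> W z.
  by move=> /scover[y ys]; exact: Wcover.
have Mgx : Q (g x) by rewrite /Q /= -iterSr iterS Mx.
by move: (We x Mx) (cover x Mx) (cover _ Mgx); case: (W x) (W (g x)) => [t|] [t'|].
Qed.

(** * Labellings along the edges of a graph *)

(** A point is bad if the labelling [V0] provided for the points fixed by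
    [g^(L!)] does not follow an edge there.  Bad points are not fixed by
    [g^(L!)], hence have no period smaller than [L], and they form a clopen set,
    so that markers can be placed close to all of them.  By aperiodicity some
    point [y0] is not fixed by [g^(L!)]; a clopen neighbourhood [E] of such a
    point is counted as bad too, to make sure that there is a marker at all. *)
Lemma edge_labelling (Y : topologicalType) (g gi : Y -> Y) (T : finType)
    (e : T -> T -> Prop) (L : nat) (t0 : T) :
  compact [set: Y] -> totally_separated Y ->
  continuous g -> continuous gi -> cancel g gi -> cancel gi g ->
  aperiodic g -> 0 < L ->
  (forall u v l, L <= l -> exists w, covering_walk e u v l w) ->
  (forall n, Per g n -> exists u w, walk e u u n w) ->
  exists V : Y -> T, [/\ locally_constant V, forall y, e (V y) (V (g y)) &
    forall t, exists y, V y = t].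
Proof.
move=> Ycompact Ysep gcont gicont gK giK gaper L0 covering gper.
have M0 := fact_gt0 L; set M := L`! in M0.
have [V0 V0lc V0e] := periodic_labelling t0 Ycompact Ysep gcont M0 gper.
have /existsNP[y0 /(not_fixed_nbhd Ysep (continuous_iter (n := M) gcont))] := gaper M M0.
case=> E Elc [Ey0 EM].
pose bad y := ~~ `[< e (V0 y) (V0 (g y)) >] || E y.
have bad_lc : locally_constant bad.
  apply: locally_constant_comp2 => //.
  apply: (locally_constant_comp2 (fun u v => ~~ `[< e u v >])) => //.
  exact: (locally_constant_preimage gcont).
have bad_nonperiodic y i : bad y -> 0 < i < L -> iter i g y <> y.
  move=> bady /andP[i0 iL] iy.
  have iM : i %| M by apply: dvdn_fact; rewrite i0 ltnW.
  have My : iter M g y = y by rewrite -(divnK iM) mulnC iter_period.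
  by case/orP: bady => [/asboolP[]|/EM //]; exact: V0e.
have /choice[D Dbad] (y : Y) : exists D : Y -> bool, bad y ->
    [/\ locally_constant D, D y & no_return g L D].
  have [bady|_] := boolP (bad y); last by exists (fun=> true).
  have [D Dlc [Dy Dn]] := exists_no_return_nbhd Ysep gcont
    (fun i => @bad_nonperiodic y i bady).
  by exists D.
have [y /Dbad[]//|s sbad scover] := finite_locally_constant_cover (D := D)
  Ycompact (locally_constant_closed bad_lc).
have [y /sbad/Dbad[]//|F Flc [Fn Fcover]] :=
  exists_markers (D := D) (s := s) gcont gicont gK giK L0.
have marked_bad y : bad y -> marked g gi F L y.
  by move=> /scover[z zs Dzy]; exact: Fcover Dzy.
apply: (labelling_from_markers gcont gicont gK giK L0 covering Flc Fn _ V0lc).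
  have /marked_bad/markedP[i _ /orP[]] : bad y0 by rewrite /bad Ey0 orbT.
    by exists (iter i g y0).
  by exists (iter i gi y0).
move=> y; apply: contraNP => ney; apply: marked_bad.
by apply/orP; left; apply/asboolP.
Qed.

(** * Compact metric spaces *)

Local Open Scope ring_scope.

Section Metric.
Context (R : realType) (X : metricType R).
Hypothesis Xcompact : compact [set: X].

Lemma lebesgue_number (P : X -> X -> Prop) :
  (forall x : X, exists2 O : set X, nbhs x O & forall a b, O a -> O b -> P a b) ->
  exists2 d : R, 0 < d & forall a b, mdist a b < d -> P a b.
Proof.
move=> Ploc; have /compact_near_coveringP/(_ _ (0^'+ : set_system R)
  (fun d a => forall b, mdist a b < d -> P a b) (at_right_proper_filter 0)) := Xcompact.
case=> [x _|d /= d0 dP].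
  have [O /nbhs_mdistP[r r0 rO] OP] := Ploc x.
  have r20 : 0 < r / 2 by rewrite divr_gt0.
  exists ([set z | mdist x z < r / 2], [set d | d < r / 2]).
    split; first by apply/nbhs_mdistP; exists (r / 2).
    exact: nbhs_right_lt.
  move=> [a d] /= [xa dr] b ab; apply: OP; apply: rO.
    by rewrite /= (lt_trans xa) // ltr_pdivrMr // ltr_pMr // ltr1n.
  apply: le_lt_trans (metric_triangle _ a _) _.
  by rewrite [ltRHS]splitr ltrD // (lt_trans ab).
exists (d / 2); first by rewrite divr_gt0.
move=> a b ab; apply: (dP (d / 2)) => //=; rewrite ?divr_gt0 //.
  rewrite sub0r normrN gtr0_norm ?divr_gt0 //.
  by rewrite ltr_pdivrMr // ltr_pMr // ltr1n.
Qed.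

Lemma uniformly_continuous (f : X -> X) (eps : R) : continuous f -> 0 < eps ->
  exists2 d : R, 0 < d & forall a b, mdist a b < d -> mdist (f a) (f b) < eps.
Proof.
move=> fcont eps0; apply: lebesgue_number => x.
have e20 : 0 < eps / 2 by rewrite divr_gt0.
exists (f @^-1` [set z | mdist (f x) z < eps / 2]).
  by apply: fcont; apply/nbhs_mdistP; exists (eps / 2).
move=> a b /= fa fb; apply: le_lt_trans (metric_triangle _ (f x) _) _.
by rewrite [ltRHS]splitr ltrD // metric_sym.
Qed.

Lemma uniformly_locally_constant (T : Type) (U : X -> T) : locally_constant U ->
  exists2 d : R, 0 < d & forall a b, mdist a b < d -> U a = U b.
Proof.
move=> Ulc; apply: lebesgue_number => x; exists [set z | U z = U x].
  exact: Ulc.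
by move=> a b /= -> ->.
Qed.

(** Needed because the supremum of an unbounded set is 0 by convention, so that
    [sup_dist] bounds the distances only when they are bounded. *)
Lemma mdist_bounded : exists B : R, forall a b : X, mdist a b <= B.
Proof.
have [x0|noX] := pselect (exists x0 : X, True); last first.
  by exists 0 => a; case: noX; exists a.
case: x0 => x0 _.
have /compact_near_coveringP/(_ _ \oo
  (fun n a => mdist x0 a < n%:R)) := Xcompact.
case=> [x _|n _ nP].
  exists ([set z | mdist x z < 1], [set n | (Num.bound (mdist x0 x + 1) <= n)%N]).
    by split; [apply/nbhs_mdistP; exists 1 => /=|exists (Num.bound (mdist x0 x + 1))].
  move=> [a n] /= [xa Bn]; apply: le_lt_trans (metric_triangle _ x _) _.
  apply: lt_le_trans (_ : mdist x0 x + 1 <= _); first by rewrite ltrD2l.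
  apply: ltW; apply: lt_le_trans (_ : (Num.bound (mdist x0 x + 1))%:R <= _).
    by rewrite archi_boundP // addr_ge0 // mdist_ge0.
  by rewrite ler_nat.
exists (n%:R + n%:R) => a b; apply: le_trans (metric_triangle _ x0 _) _.
by apply/ltW/ltrD; [rewrite metric_sym|]; exact: (nP n (leqnn n)).
Qed.

Lemma le_sup_dist (f f' : X -> X) (x : X) : mdist (f x) (f' x) <= sup_dist f f'.
Proof.
have [B XB] := mdist_bounded.
by apply: ub_le_sup; [exists B => _ [z _ <-]; exact: XB|exists x].
Qed.

Lemma sup_dist_le (f f' : X -> X) (eps : R) : 0 <= eps ->
  (forall x, mdist (f x) (f' x) <= eps) -> sup_dist f f' <= eps.
Proof.
move=> eps0 ffeps; have [[x]|noX] := pselect (exists x0 : X, True).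
  move=> _; apply: sup_le_ub => [|_ [z _ <-] //]; by exists (mdist (f x) (f' x)), x.
rewrite /sup_dist (_ : [set _ | _ in _] = set0) ?sup0 //.
by apply/seteqP; split=> // r [x]; case: noX; exists x.
Qed.

Lemma sup_dist_ge0 (f f' : X -> X) : 0 <= sup_dist f f'.
Proof.
have [[x _]|noX] := pselect (exists x0 : X, True).
  exact: le_trans (mdist_ge0 _ _) (le_sup_dist f f' x).
rewrite /sup_dist (_ : [set _ | _ in _] = set0) ?sup0 //.
by apply/seteqP; split=> // r [x]; case: noX; exists x.
Qed.

Lemma cvg_iter_uniform (I : Type) (F : set_system I) (FF : Filter F)
    (f_ : I -> X -> X) (f : X -> X) (z_ : I -> X) (z : X) (n : nat) :
  continuous f ->
  (forall eps : R, 0 < eps ->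
    \forall i \near F, forall x, mdist (f x) (f_ i x) < eps) ->
  z_ @ F --> z -> iter n (f_ i) (z_ i) @[i --> F] --> iter n f z.
Proof.
move=> fcont f_f z_z; elim: n => [//|n IHn].
apply/cvgrPdist_lt => eps eps0.
have e20 : 0 < eps / 2 by rewrite divr_gt0.
have /cvgrPdist_lt/(_ _ e20) :
  f (iter n (f_ i) (z_ i)) @[i --> F] --> f (iter n f z).
  exact: (@continuous_cvg I X X F FF (fun i => iter n (f_ i) (z_ i)) f _ (fcont _) IHn).
apply: filter_app; apply: filterS (f_f _ e20) => i fi_f f_iter.
apply: le_lt_trans (metric_triangle _ (f (iter n (f_ i) (z_ i))) _) _.
by rewrite [ltRHS]splitr ltrD.
Qed.

End Metric.

(** * Periods survive in the limit *)
Section Necessity.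
Context (R : realType) (Y X : metricType R).
Hypothesis Xcompact : compact [set: X].

(** If f has no point of period [n], then no point near [x] is fixed by the
    n-th iterate of a map close to f, for each [x]; by compactness this holds on
    all of X for all large [k], which contradicts that [psi k y] is fixed by the
    n-th iterate of the k-th conjugate. *)
Lemma approximates_Per (g : Y -> Y) (f : X -> X) : continuous f ->
  approximates g f -> Per g `<=` Per f.
Proof.
move=> fcont [psi [phi [homeo cvg_f]]] n [n0 [y gny]]; split=> //.
apply: contrapT => nofix.
pose f_ k := psi k \o g \o phi k.
have f_f eps : 0 < eps -> \forall k \near \oo, forall x, mdist (f x) (f_ k x) < eps.
  move=> eps0; have /cvg_ballP/(_ _ eps0) := cvg_f.
  apply: filterS => k; rewrite /ball /= sub0r normrN => keps x.
  rewrite metric_sym; apply: le_lt_trans (le_lt_trans (ler_norm _) keps).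
  exact: le_sup_dist.
have f_fixed k : iter n (f_ k) (psi k y) = psi k y.
  have [_ _ psiK _] := homeo k; rewrite -[RHS](congr1 (psi k) gny).
  by elim: n {n0 gny nofix} => //= m ->; rewrite /f_ /= psiK.
have /compact_near_coveringP/(_ _ \oo (fun k x => psi k y <> x)) := Xcompact.
case=> [x _|k _ kP]; last by apply: (kP k (leqnn k) (psi k y)).
have fx : x <> iter n f x by move=> fx; apply: nofix; exists x.
have eps0 : 0 < mdist x (iter n f x) / 2 by rewrite divr_gt0 // mdist_gt0; apply/eqP.
have /cvgrPdist_lt/(_ _ eps0) :
    iter n (f_ i.2) i.1 @[i --> (nbhs x, \oo)] --> iter n f x.
  apply: cvg_iter_uniform => //; last exact: cvg_fst.
  by move=> eps eps1; apply: (cvg_snd (f_f _ eps1)).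
have : \forall i \near (nbhs x, (\oo : set_system nat)),
    mdist x i.1 < mdist x (iter n f x) / 2.
  exists ([set z | mdist x z < mdist x (iter n f x) / 2], setT) => [|[z k] []//].
  split; last exact: filterT.
  by apply/nbhs_mdistP; exists (mdist x (iter n f x) / 2).
apply: filter_app2; near=> i => /= xz fz zE.
move: fz; rewrite -zE f_fixed zE => fz.
have := metric_triangle x i.1 (iter n f x); rewrite leNgt => /negP; apply.
by rewrite [ltRHS]splitr ltrD // metric_sym.
Unshelve. all: by end_near. Qed.

End Necessity.

(** * The transition graph of a fine partition *)

(** The cylinders of length [n], transported to X.  Some cylinder around each
    point of X is small, and by compactness one length suffices for all. *)
Lemma fine_cantor_partition (R : realType) (X : metricType R) (eps : R) :
  compact [set: X] -> homeomorphic X cantor_space -> 0 < eps ->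
  exists n (U : X -> n.-tuple bool), [/\ locally_constant U,
    forall t, exists x, U x = t & forall a b, U a = U b -> mdist a b < eps].
Proof.
move=> Xcompact [h [k [hcont kcont hK kK]]] eps0.
have near_h_agree n x : \forall z \near x, agree n (h x) (h z).
  exact: (hcont x _ (near_agree n (h x))).
have /compact_near_coveringP/(_ _ \oo
  (fun n a => forall b, agree n (h a) (h b) -> mdist a b < eps)) := Xcompact.
case=> [x _|n _ nP].
  have e20 : 0 < eps / 2 by rewrite divr_gt0.
  have [n nx] : exists n, forall c, agree n (h x) c -> mdist x (k c) < eps / 2.
    apply: (@cylinder_basis (h x) (k @^-1` [set z | mdist x z < eps / 2])).
    by apply: kcont; rewrite hK; apply/nbhs_mdistP; exists (eps / 2).
  exists ([set z | agree n (h x) (h z)], [set m | (n <= m)%N]).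
    by split; [exact: near_h_agree|exists n].
  move=> [a m] /= [xa nm] b ab.
  apply: le_lt_trans (metric_triangle _ x _) _; rewrite [ltRHS]splitr metric_sym.
  rewrite ltrD // -[X in mdist x X]hK; apply: nx => // i i_n.
  by rewrite ab ?xa // (leq_trans i_n).
exists n, (fun x => [tuple h x i | i < n]); split.
- move=> x; apply: filterS (near_h_agree n x) => z xz.
  by apply: eq_mktuple => i; exact: xz.
- move=> t; exists (k (fun i => nth false t i)).
  by apply: eq_from_tnth => i; rewrite tnth_mktuple kK (tnth_nth false).
move=> a b ab; apply: (nP n (leqnn n)) => // i i_n.
by have /(congr1 (fun t => tnth t (Ordinal i_n))) := ab; rewrite !tnth_mktuple.
Qed.

Section TransitionGraph.
Context (R : realType) (X : metricType R) (f : X -> X) (T : finType) (U : X -> T).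
Hypotheses (Xcompact : compact [set: X]) (Ulc : locally_constant U).
Hypothesis Usurj : forall t, exists x, U x = t.

Definition transition u v := exists x, U x = u /\ U (f x) = v.

(** If the error [d] is a Lebesgue number of the partition, the labels of a
    [d]-chain form a walk: the chain step from [a] to [b] has [b] close to
    [f a], hence of the same label. *)
Lemma chain_mixing_walks : chain_mixing f -> exists2 N, (0 < N)%N &
  forall u v l, (N <= l)%N -> exists w, walk transition u v l w.
Proof.
move=> fmix; have [d d0 Ud] := uniformly_locally_constant Xcompact Ulc.
have /choice[x Ux] := Usurj.
have /choice[N NP] (uv : T * T) := fmix d d0 (x uv.1) (x uv.2).
exists (\max_uv N uv).+1 => // u v l Nl.
have [_ /(_ l)[|p [<- /pathP pd plast]]] := NP (u, v).
  exact: leq_trans (leq_bigmax (u, v)) (ltnW Nl).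
exists (fun i => U (nth (x u) (x u :: p) i)); split=> [||i ip].
- exact: Ux.
- by rewrite -last_nth plast Ux.
exists (nth (x u) (x u :: p) i); split=> //=.
by apply: Ud; exact: pd.
Qed.

Lemma Per_closed_walk n : Per f n -> exists u w, walk transition u u n w.
Proof.
move=> [_ [x fx]]; exists (U x), (fun i => U (iter i f x)); split=> //.
  by rewrite fx.
by move=> i _; exists (iter i f x).
Qed.

End TransitionGraph.

(** At a point [x], the map psi g phi and [f] are compared through a point [x']
    that witnesses the edge followed: [x'] has the label of [x], and [f x'] has
    the label of psi (g (phi x)). *)
Lemma approximating_homeomorphism (R : realType) (X Y : metricType R)
    (f : X -> X) (g : Y -> Y) (eps : R) :
  compact [set: X] -> compact [set: Y] ->
  homeomorphic X cantor_space -> homeomorphic Y cantor_space ->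
  continuous f -> chain_mixing f -> homeomorphism g -> aperiodic g ->
  Per g `<=` Per f -> 0 < eps ->
  exists (psi : Y -> X) (phi : X -> Y), inverse_homeomorphisms psi phi /\
    forall x, mdist (psi (g (phi x))) (f x) < eps.
Proof.
move=> Xcompact Ycompact XC YC fcont fmix [gi [gcont gicont gK giK]] gaper gf eps0.
have e20 : 0 < eps / 2 by rewrite divr_gt0.
have [d d0 fd] := uniformly_continuous Xcompact fcont e20.
have m0 : 0 < Order.min d (eps / 2) by rewrite lt_min d0.
have [n [U [Ulc Usurj Usmall]]] := fine_cantor_partition Xcompact XC m0.
have [N N0 Nwalk] := chain_mixing_walks Xcompact Ulc Usurj fmix.
have [L L0 Lwalk] := exists_covering_walk N0 Nwalk.
have [V [Vlc Ve Vsurj]] := edge_labelling [tuple of nseq n false] Ycompact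
  (cantor_totally_separated YC) gcont gicont gK giK gaper L0 Lwalk
  (fun n pn => Per_closed_walk U (gf n pn)).
have [psi [phi [homeo UV]]] := homeomorphisms_matching_partitions XC YC Ulc Vlc Usurj Vsurj.
exists psi, phi; split=> // x; have [_ _ _ phiK] := homeo.
have [x' [Ux' Ufx']] := Ve (phi x).
rewrite -UV phiK in Ux'; rewrite -UV in Ufx'.
apply: le_lt_trans (metric_triangle _ (f x') _) _; rewrite [ltRHS]splitr ltrD //.
  by have := Usmall _ _ (esym Ufx'); rewrite lt_min => /andP[].
by apply: fd; have := Usmall _ _ Ux'; rewrite lt_min => /andP[].
Qed.

Theorem theorem1p1 (R : realType) (X Y : metricType R)
  (Xcompact : compact [set: X]) (Ycompact : compact [set: Y])
  (Xcantor : homeomorphic X cantor_space)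
  (Ycantor : homeomorphic Y cantor_space)
  (f : X -> X) (fcont : continuous f)
  (fsurj : set_surj [set: X] [set: X] f)
  (fmix : chain_mixing f)
  (g : Y -> Y) (ghomeo : homeomorphism g) (gaper : aperiodic g) :
  Per g `<=` Per f <-> approximates g f.
Proof.
split=> [gf|]; last exact: approximates_Per.
have /choice[psi /choice[phi hpsi]] (k : nat) :=
  approximating_homeomorphism Xcompact Ycompact Xcantor Ycantor fcont fmix
    ghomeo gaper gf (ltac:(by rewrite invr_gt0) : 0 < k.+1%:R^-1 :> R).
exists psi, phi; split=> [k|]; first by have [] := hpsi k.
apply/cvg_ballP => eps eps0; exists (Num.bound eps^-1) => // k /= ek.
rewrite /ball /= sub0r normrN ger0_norm ?sup_dist_ge0 //.
apply: le_lt_trans (_ : k.+1%:R^-1 < _).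
  apply: sup_dist_le => [|x]; first by rewrite invr_ge0.
  by apply: ltW; have [_] := hpsi k; exact.
rewrite invf_plt ?posrE //; apply: lt_le_trans (archi_boundP _) _.
  by rewrite invr_ge0 ltW.
by rewrite ler_nat leqW.
Qed.
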